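(* Let $\mathcal{H}$ and $\mathcal{H}'$ be connected (multi)hypergraphs that have perfect colorings with the same incidence parameters $(V,W)$. That is, there are perfect colorings of $\mathcal{H}$ and of $\mathcal{H}'$ with the same color set $\{1,\dots,k\}$ and the same list $\gamma_1,\dots,\gamma_l$ of occurring color ranges, having the same matrices $V$ and $W$. Then there is a (multi)hypergraph $\mathcal{G}$ that covers both $\mathcal{H}$ and $\mathcal{H}'$.
   Context: A multihypergraph $(X,E)$ has a finite vertex set $X$ and a finite multiset $E$ of nonempty subsets of $X$ (hyperedges). It is connected if any two vertices are joined by a Berge path, i.e., an alternating sequence of vertices and hyperedges with consecutive elements incident. A coloring is a surjective map $f:X\to\{1,\dots,k\}$. The color range of a hyperedge $e$ is the multiset $f(e)=\{f(x):x\in e\}$. Let $\gamma_1,\dots,\gamma_l$ be the distinct color ranges that occur. The coloring is perfect if for all $i,j$ every vertex of color $i$ lies in the same number $v_{i,j}$ of hyperedges of color range $\gamma_j$. With $w_{j,i}$ the multiplicity of $i$ in $\gamma_j$, the pair $V=(v_{i,j})$ ($k\times l$), $W=(w_{j,i})$ ($l\times k$) is the incidence parameters of the coloring. A (multi)hypergraph $\mathcal{G}$ covers $\mathcal{H}$ if there are a surjective vertex map $\varphi$ and a hyperedge map $\psi$ with the following properties: - for every hyperedge $e$ of $\mathcal{G}$, $\varphi$ is injective on $e$ and $\varphi(e)$ is the vertex set of the hyperedge $\psi(e)$ of $\mathcal{H}$; - for every vertex $x$ of $\mathcal{G}$, $\psi$ restricts to a bijection from the hyperedges containing $x$ onto the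 hyperedges containing $\varphi(x)$. *)

(* Defs.v *)
From mathcomp Require Import all_boot all_order all_algebra.
From mathcomp Require Import finmap multiset.

Set Implicit Arguments.
Unset Strict Implicit.
Unset Printing Implicit Defensive.

(* The multiset of hyperedges is a family of nonempty vertex sets indexed by a *)
(* finite type: hyperedges with the same vertex set are told apart by their    *)
(* index.                                                                      *)
Record multihypergraph := Multihypergraph {
  vertex : finType;
  hyperedge : finType;
  ends : hyperedge -> {set vertex};
  ends_neq0 : forall e, ends e != set0
}.

(* p lists the successive steps (hyperedge crossed, vertex reached) from x. *)
Fixpoint berge_path (H : multihypergraph) (x : vertex H)
    (p : seq (hyperedge H * vertex H)) : bool :=
  if p is (e, y) :: p' then
    [&& x \in ends e, y \in ends e & berge_path y p']
  else true.

Definition connected (H : multihypergraph) : Prop :=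
  forall x y : vertex H,
    exists2 p, berge_path x p & last x [seq s.2 | s <- p] = y.

Definition star (H : multihypergraph) (x : vertex H) : {set hyperedge H} :=
  [set e | x \in ends e].

Definition surjective (A B : Type) (f : A -> B) : Prop :=
  forall b, exists a, f a = b.

(* The colors 1, ..., k are represented by 'I_k = {0, ..., k-1}. *)
Definition color_range (H : multihypergraph) (k : nat) (f : vertex H -> 'I_k)
    (e : hyperedge H) : {mset 'I_k}%mset :=
  seq_mset [seq f x | x in ends e].

Definition lists_color_ranges (H : multihypergraph) (k l : nat)
    (f : vertex H -> 'I_k) (gamma : 'I_l -> {mset 'I_k}%mset) : Prop :=
  injective gamma /\
  forall g, (exists j, gamma j = g) <-> (exists e, color_range f e = g).

(* f is a perfect coloring whose distinct color ranges are gamma_1, ...,       *)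
(* gamma_l, and (V, W) are its incidence parameters for this numbering. For    *)
(* g : {mset 'I_k}, g i is the multiplicity of i in g.                         *)
Record perfect_coloring (H : multihypergraph) (k l : nat)
    (f : vertex H -> 'I_k) (gamma : 'I_l -> {mset 'I_k}%mset)
    (V : 'M[nat]_(k, l)) (W : 'M[nat]_(l, k)) : Prop := PerfectColoring {
  coloring_surjective : surjective f;
  coloring_ranges : lists_color_ranges f gamma;
  coloring_vertex_params : forall (i : 'I_k) (j : 'I_l) (x : vertex H),
    f x = i -> #|[set e in star x | color_range f e == gamma j]| = V i j;
  coloring_range_params : forall (j : 'I_l) (i : 'I_k), W j i = gamma j i
}.

Definition covers (G H : multihypergraph) : Prop :=
  exists (phi : vertex G -> vertex H) (psi : hyperedge G -> hyperedge H),
    [/\ surjective phi,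
        forall e : hyperedge G,
          {in ends e &, injective phi} /\ phi @: ends e = ends (psi e)
      & forall x : vertex G,
          {in star x &, injective psi} /\ psi @: star x = star (phi x)].

(* Main.v *)
(* Leighton's construction. Encode a hypergraph by its incidence graph, with    *)
(* vertices colored by f and hyperedges by their color range. Among the         *)
(* neighbours of a given color, rank those of every node by 0, ..., d - 1.      *)
(* A vertex of the cover is a triple (x, x', t) with x, x' of the same color i  *)
(* and t < N i; a hyperedge is a triple (e, e', u) with e, e' of the same color *)
(* j and u < M j. They are incident when x is on e, x' is on e', the numbers    *)
(* rank + rank' + t and rank + rank' + u vanish modulo V i j and W j i, and     *)
(* t %/ V i j = u %/ W j i. The congruences turn t into a bijection between     *)
(* the stars of x and x', and u into one between e and e'; the quotients match  *)
(* up what remains provided N i / V i j = M j / W j i. Double counting of the   *)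
(* incidences of H shows that N i = C / |X_i| and M j = C / |E_j| do for every  *)
(* sufficiently divisible C.                                                    *)
Require Import Defs.
From mathcomp Require Import all_boot all_order all_algebra.
From mathcomp Require Import finmap multiset.

Set Implicit Arguments.
Unset Strict Implicit.
Unset Printing Implicit Defensive.

(** Seen through the incidence graph, a perfect coloring says that the number of neighbours of each
    color depends only on the color of the node, and [V] and [W] record these numbers
    ([perfect_coloring_regular]). A covering is then a map along which incidences lift uniquely. In
    the construction above, a node of the cover and a neighbour [b] of its first component determine
    the neighbour lying over [b]: one congruence gives the rank of [b'], the other the remainder of
    [u], and the shared quotient the rest ([glued_exists], [glued_unique]). The construction is
    symmetric in vertices and hyperedges ([glued_flip]) and in the two hypergraphs ([glued_swap]),
    so this one-sided lifting suffices. [double_count] makes the sizes of the fibers compatible. *)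

(** * Bicolored bipartite graphs and ranks of neighbours *)

Record bicolored (K L : eqType) := Bicolored {
  lnode : finType;
  rnode : finType;
  inc : lnode -> rnode -> bool;
  lcol : lnode -> K;
  rcol : rnode -> L
}.

(** Lifting is proved from the left side only; applied to [flip H] it gives the right side. *)
Definition flip K L (H : bicolored K L) : bicolored L K :=
  Bicolored (fun b a => inc a b) (@rcol K L H) (@lcol K L H).

Definition nbrs K L (H : bicolored K L) (a : lnode H) (j : L) : {set rnode H} :=
  [set b | inc a b & rcol b == j].

(** An incident pair carries two unrelated ranks: this one at [a], and the one at [b], obtained
    through [flip]. *)
Definition rank K L (H : bicolored K L) (a : lnode H) (b : rnode H) : nat :=
  index b (enum (nbrs a (rcol b))).

Definition lregular K L (H : bicolored K L) (v : K -> L -> nat) : Prop :=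
  forall (a : lnode H) (j : L), #|nbrs a j| = v (lcol a) j.

Lemma ltn_rank K L (H : bicolored K L) v (a : lnode H) (b : rnode H) :
  lregular H v -> inc a b -> rank a b < v (lcol a) (rcol b).
Proof. by move=> rH ab; rewrite -rH cardE index_mem mem_enum inE ab eqxx. Qed.

Lemma rank_inj K L (H : bicolored K L) (a : lnode H) (b1 b2 : rnode H) :
  inc a b1 -> inc a b2 -> rcol b1 = rcol b2 -> rank a b1 = rank a b2 -> b1 = b2.
Proof.
move=> ab1 ab2 eqc; rewrite /rank -eqc; apply: (index_inj b1); rewrite mem_enum inE.
  by rewrite ab1 eqxx.
by rewrite ab2 eqc eqxx.
Qed.

Lemma rank_onto K L (H : bicolored K L) v (a : lnode H) (j : L) r :
    lregular H v -> r < v (lcol a) j ->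
  exists b : rnode H, [/\ inc a b, rcol b = j & rank a b = r].
Proof.
rewrite /lregular => rH; rewrite -rH => lt_r.
have /card_gt0P[b0 _] := leq_ltn_trans (leq0n r) lt_r.
rewrite cardE in lt_r.
set b := nth b0 (enum (nbrs a j)) r.
have : b \in nbrs a j by rewrite -mem_enum mem_nth.
rewrite inE => /andP[ab /eqP cb]; exists b; split => //.
by rewrite /rank cb index_uniq ?enum_uniq.
Qed.

Lemma complement_mod d n : 0 < d -> exists2 r, r < d & d %| n + r.
Proof.
move=> d_gt0; exists ((d - n %% d) %% d); first by rewrite ltn_mod.
by rewrite /dvdn modnDmr -modnDml subnKC ?modnn // ltnW ?ltn_mod.
Qed.

Lemma modn_complement_eq d n r s : d %| n + r -> d %| n + s -> r = s %[mod d].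
Proof. by move=> /eqP nr /eqP ns; apply/eqP; rewrite -(eqn_modDl n) nr ns. Qed.

(** * Unique lifting of incidences in the glued graph *)

Section Gluing.

Variables (K L : eqType) (v : K -> L -> nat) (w : L -> K -> nat) (C : nat).

(** One index type ['I_C] serves all colors, so that the nodes of the cover form a subtype of a
    product; the bound proper to each color is imposed here. *)
Definition fiber (T : eqType) (A A' : finType) (c : A -> T) (c' : A' -> T)
    (N : T -> nat) (p : A * A' * 'I_C) : bool :=
  (c p.1.1 == c' p.1.2) && (p.2 < N (c p.1.1)).

Definition glued (H H' : bicolored K L)
    (p : lnode H * lnode H' * 'I_C) (q : rnode H * rnode H' * 'I_C) : bool :=
  let: (a, a', t) := p in let: (b, b', u) := q in
  let d := v (lcol a) (rcol b) in let d' := w (rcol b) (lcol a) in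
  [&& inc a b, inc a' b', d %| rank a b + rank a' b' + t,
      d' %| @rank _ _ (flip H) b a + @rank _ _ (flip H') b' a' + u
    & t %/ d == u %/ d'].

Variables (H H' : bicolored K L) (N : K -> nat) (M : L -> nat).
Hypotheses (rH : lregular H v) (rH' : lregular H' v)
           (rfH : lregular (flip H) w).
Hypothesis MC : forall j, M j <= C.
Hypothesis NM : forall i j, 0 < v i j -> 0 < w j i ->
  [/\ v i j %| N i, w j i %| M j & N i %/ v i j = M j %/ w j i].

Lemma glued_exists (p : lnode H * lnode H' * 'I_C) (b : rnode H) :
    fiber (@lcol _ _ H) (@lcol _ _ H') N p -> inc p.1.1 b ->
  exists q : rnode H * rnode H' * 'I_C,
    [/\ q.1.1 = b, fiber (@rcol _ _ H) (@rcol _ _ H') M q & glued p q].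
Proof.
case: p => [[a a'] t] /andP[/= /eqP caa' ltt] ab.
have d_gt0 := leq_ltn_trans (leq0n _) (ltn_rank rH ab).
have e_gt0 := leq_ltn_trans (leq0n _) (@ltn_rank _ _ (flip H) w b a rfH ab).
rewrite /= in e_gt0.
have [dN dM eqNM] := NM d_gt0 e_gt0.
(* [r] is the rank at [a'] that the first congruence forces on [b']. *)
have [r ltr dr] := complement_mod (rank a b + t) d_gt0.
have [b' [ab' cb' rkb']] : exists b' : rnode H',
    [/\ inc a' b', rcol b' = rcol b & rank a' b' = r].
  by apply: (rank_onto rH'); rewrite -caa'.
have [s lts ds] := complement_mod
  (@rank _ _ (flip H) b a + @rank _ _ (flip H') b' a') e_gt0.
set d := v _ _ in d_gt0 dN eqNM ltr dr; set e := w _ _ in e_gt0 dM eqNM lts ds.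
(* The quotient of [u] is that of [t], which is below [N i %/ d = M j %/ e]; its remainder is
   [s]. *)
have ltu : t %/ d * e + s < M (rcol b).
  rewrite -(divnK dM) -eqNM; apply: (@leq_trans ((t %/ d).+1 * e)).
    by rewrite mulSn addnC ltn_add2r.
  by rewrite leq_mul2r ltn_divLR // divnK // ltt orbT.
exists (b, b', Ordinal (leq_trans ltu (MC _))); split=> //=.
  by rewrite /fiber /= cb' eqxx ltu.
rewrite ab ab' rkb' -/d -/e addnAC dr addnCA dvdn_addr ?dvdn_mull //= ds.
by rewrite divnMDl // (divn_small lts) addn0 eqxx.
Qed.

(** The two candidates for [b'] have ranks that are congruent modulo [v] and below it, hence equal;
    then [u1] and [u2] share quotient and remainder. *)
Lemma glued_unique (p : lnode H * lnode H' * 'I_C) q1 q2 :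
    fiber (@lcol _ _ H) (@lcol _ _ H') N p ->
    fiber (@rcol _ _ H) (@rcol _ _ H') M q1 ->
    fiber (@rcol _ _ H) (@rcol _ _ H') M q2 ->
    glued p q1 -> glued p q2 -> q1.1.1 = q2.1.1 -> q1 = q2.
Proof.
case: p q1 q2 => [[a a'] t] [[b b1] u1] [[b2 b2'] u2] /andP[/= /eqP caa' _].
move=> /andP[/= /eqP cb1 _] /andP[/= /eqP cb2 _].
move=> /and5P[ab ab1 dt1 du1 /eqP tu1] /and5P[_ ab2 dt2 du2 /eqP tu2] /= eqb.
rewrite -{b2}eqb in cb2 dt2 du2 tu2 *.
have eqb12 : b1 = b2'.
  apply: (rank_inj ab1 ab2); first by rewrite -cb1.
  have := ltn_rank rH' ab1; have := ltn_rank rH' ab2.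
  rewrite -cb1 -cb2 -caa' => lt2 lt1.
  rewrite -(modn_small lt1) -(modn_small lt2).
  by apply: (@modn_complement_eq _ (rank a b + t)); rewrite addnAC.
subst b2'; congr (_, _, _); apply: val_inj => /=.
rewrite (divn_eq u1 (w (rcol b) (lcol a))) -tu1 tu2.
by rewrite (modn_complement_eq du1 du2) -divn_eq.
Qed.

End Gluing.

(** * Symmetries of the gluing *)

Lemma glued_flip K L v w C (H H' : bicolored K L)
    (p : lnode H * lnode H' * 'I_C) (q : rnode H * rnode H' * 'I_C) :
  @glued L K w v C (flip H) (flip H') q p = @glued K L v w C H H' p q.
Proof.
case: p q => [[a a'] t] [[b b'] u] /=.
by rewrite [X in [&& _, _, _, _ & X]]eq_sym [X in [&& _, _ & X]]andbCA.
Qed.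

Definition swap (A A' I : Type) (p : A * A' * I) : A' * A * I :=
  (p.1.2, p.1.1, p.2).

Lemma swapK A A' I : cancel (@swap A A' I) (@swap A' A I).
Proof. by case=> [[]]. Qed.

Lemma fiber_swap C (T : eqType) (A A' : finType) (c : A -> T) (c' : A' -> T) N
    (p : A * A' * 'I_C) :
  fiber c' c N (swap p) = fiber c c' N p.
Proof. by rewrite /fiber /= eq_sym; case: eqP => // ->. Qed.

(** The moduli are read off the first components, so the colors must agree for them to survive the
    exchange. *)
Lemma glued_swap K L v w C (H H' : bicolored K L)
    (p : lnode H * lnode H' * 'I_C) (q : rnode H * rnode H' * 'I_C) :
    lcol p.1.1 = lcol p.1.2 -> rcol q.1.1 = rcol q.1.2 ->
  glued v w (swap p) (swap q) = glued v w p q.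
Proof.
case: p q => [[a a'] t] [[b b'] u] /= -> ->.
by rewrite andbCA [rank a' _ + _]addnC [@rank _ _ (flip H') _ _ + _]addnC.
Qed.

(** * Coverings: criterion, composition, isomorphisms *)

Definition incidence_graph (H : multihypergraph) (K L : eqType)
    (f : vertex H -> K) (g : hyperedge H -> L) : bicolored K L :=
  Bicolored (fun x e => x \in ends e) f g.

Lemma covers_unique_lift (G H : multihypergraph)
    (phi : vertex G -> vertex H) (psi : hyperedge G -> hyperedge H) :
    surjective phi ->
    (forall x e, x \in ends e -> phi x \in ends (psi e)) ->
    (forall e y, y \in ends (psi e) -> exists2 x, phi x = y & x \in ends e) ->
    (forall x e, phi x \in ends e -> exists2 h, psi h = e & x \in ends h) ->
    (forall e, {in ends e &, injective phi}) ->
    (forall x, {in star x &, injective psi}) ->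
  covers G H.
Proof.
move=> phi_onto hom liftv lifte injv inje; exists phi, psi; split=> // [e|x].
  split=> //; apply/setP=> y; apply/imsetP/idP => [[x xe ->]|/liftv[x <- xe]].
    exact: hom.
  by exists x.
split=> //; apply/setP=> e; rewrite inE.
apply/imsetP/idP => [[h + ->]|/lifte[h <- xh]]; first by rewrite inE; apply: hom.
by exists h; rewrite ?inE.
Qed.

Lemma covers_trans (G1 G2 G3 : multihypergraph) :
  covers G1 G2 -> covers G2 G3 -> covers G1 G3.
Proof.
move=> [p1 [q1 [s1 e1 st1]]] [p2 [q2 [s2 e2 st2]]].
exists (p2 \o p1), (q2 \o q1); split=> [z|e|x].
- by have [y <-] := s2 z; have [x <-] := s1 y; exists x.
- have [inj1 im1] := e1 e; have [inj2 im2] := e2 (q1 e).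
  split; last by rewrite imset_comp im1 im2.
  move=> x y xe ye /inj2 eqp; apply: inj1 => //; apply: eqp;
    by rewrite -im1 imset_f.
have [inj1 im1] := st1 x; have [inj2 im2] := st2 (p1 x).
split; last by rewrite imset_comp im1 im2.
move=> d e xd xe /inj2 eqq; apply: inj1 => //; apply: eqq;
  by rewrite -im1 imset_f.
Qed.

Lemma iso_covers (G H : multihypergraph)
    (phi : vertex G -> vertex H) (psi : hyperedge G -> hyperedge H) :
    bijective phi -> bijective psi ->
    (forall x e, (phi x \in ends (psi e)) = (x \in ends e)) ->
  covers G H.
Proof.
move=> bphi bpsi iso; have [phi' phiK phi'K] := bphi.
have [psi' psiK psi'K] := bpsi.
apply: (@covers_unique_lift G H phi psi) => [y|x e|e y|x e|e|x].
- by exists (phi' y).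
- by rewrite iso.
- by exists (phi' y); rewrite // -iso phi'K.
- by exists (psi' e); rewrite // -iso psi'K.
- by move=> y z _ _; apply: bij_inj bphi _ _.
by move=> d e _ _; apply: bij_inj bpsi _ _.
Qed.

(** * The common cover *)

Section CommonCover.

Variables (H H' : multihypergraph) (K L : eqType).
Variables (f : vertex H -> K) (f' : vertex H' -> K).
Variables (g : hyperedge H -> L) (g' : hyperedge H' -> L).
Variables (v : K -> L -> nat) (w : L -> K -> nat).
Variables (N : K -> nat) (M : L -> nat) (C : nat).

Let I := incidence_graph f g.
Let I' := incidence_graph f' g'.

Hypotheses (rI : lregular I v) (rI' : lregular I' v)
           (rfI : lregular (flip I) w) (rfI' : lregular (flip I') w).
Hypotheses (NC : forall i, N i <= C) (MC : forall j, M j <= C).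
Hypothesis NM : forall i j, 0 < v i j -> 0 < w j i ->
  [/\ v i j %| N i, w j i %| M j & N i %/ v i j = M j %/ w j i].

Let MN i j : 0 < w i j -> 0 < v j i ->
  [/\ w i j %| M i, v j i %| N j & M i %/ w i j = N j %/ v j i].
Proof. by move=> w0 v0; have [] := NM v0 w0. Qed.

Let GV : finType := {p : vertex H * vertex H' * 'I_C | fiber f f' N p}.
Let GE : finType := {q : hyperedge H * hyperedge H' * 'I_C | fiber g g' M q}.
Let Gends (q : GE) : {set GV} := [set p | @glued K L v w C I I' (val p) (val q)].

Let Gends_neq0 q : Gends q != set0.
Proof.
(* An end of the first component lifts to an end of [q]. *)
have /set0Pn[x xe] := ends_neq0 (val q).1.1.
have [p [_ fp pq]] :=
  @glued_exists _ _ w v C (flip I) (flip I') M N rfI rfI' rI NC MN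
    (val q) x (valP q) xe.
apply/set0Pn; exists (Sub p fp : GV).
by move: pq; rewrite inE glued_flip.
Qed.

Definition common_cover : multihypergraph := Multihypergraph Gends_neq0.

Lemma common_cover_covers_left :
    (forall x, 0 < N (f x)) -> (forall x, exists x', f' x' = f x) ->
  covers common_cover H.
Proof.
move=> N_gt0 f'f.
apply: (@covers_unique_lift common_cover H (fun p : GV => (val p).1.1)
          (fun q : GE => (val q).1.1)).
- move=> x; have [x' fx'] := f'f x.
  (* The ordinal is 0. *)
  have fp : fiber f f' N (x, x', Ordinal (leq_trans (N_gt0 x) (NC _))).
    by rewrite /fiber /= fx' eqxx N_gt0.
  by exists (Sub _ fp : GV).
- by move=> [[[a a'] t] fp] [[[b b'] u] fq]; rewrite inE => /andP[].
- move=> q y yq.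
  have [p [<- fp pq]] := @glued_exists _ _ w v C (flip I) (flip I') M N
    rfI rfI' rI NC MN (val q) y (valP q) yq.
  by exists (Sub p fp : GV); rewrite // inE; move: pq; rewrite glued_flip.
- move=> p e pe.
  have [q [<- fq pq]] := @glued_exists _ _ v w C I I' N M
    rI rI' rfI MC NM (val p) e (valP p) pe.
  by exists (Sub q fq : GE); rewrite ?inE.
- move=> q p1 p2; rewrite !inE => p1q p2q eqp; apply: val_inj.
  move: p1q p2q; rewrite -!(@glued_flip _ _ v w C I I') => p1q p2q.
  exact: (@glued_unique _ _ w v C (flip I) (flip I') M N rfI' (val q) _ _
    (valP q) (valP p1) (valP p2)).
move=> p q1 q2; rewrite !inE => pq1 pq2 eqq; apply: val_inj.
exact: (@glued_unique _ _ v w C I I' N M rI' (val p) _ _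
  (valP p) (valP q1) (valP q2)).
Qed.

End CommonCover.

Definition swap_fiber C (T : eqType) (A A' : finType) (c : A -> T)
    (c' : A' -> T) N (p : {p : A * A' * 'I_C | fiber c c' N p}) :
  {p : A' * A * 'I_C | fiber c' c N p} :=
  Sub (swap (val p)) (etrans (fiber_swap c c' N (val p)) (valP p)).

Lemma swap_fiberK C (T : eqType) (A A' : finType) (c : A -> T) (c' : A' -> T) N :
  cancel (@swap_fiber C T A A' c c' N) (@swap_fiber C T A' A c' c N).
Proof. by move=> p; apply: val_inj; rewrite /= swapK. Qed.

Lemma common_covers (H H' : multihypergraph) (K L : eqType)
    (f : vertex H -> K) (f' : vertex H' -> K)
    (g : hyperedge H -> L) (g' : hyperedge H' -> L)
    (v : K -> L -> nat) (w : L -> K -> nat) (N : K -> nat) (M : L -> nat) C :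
    lregular (incidence_graph f g) v -> lregular (incidence_graph f' g') v ->
    lregular (flip (incidence_graph f g)) w ->
    lregular (flip (incidence_graph f' g')) w ->
    (forall i, 0 < N i <= C) -> (forall j, M j <= C) ->
    (forall i j, 0 < v i j -> 0 < w j i ->
      [/\ v i j %| N i, w j i %| M j & N i %/ v i j = M j %/ w j i]) ->
    surjective f -> surjective f' ->
  exists G : multihypergraph, covers G H /\ covers G H'.
Proof.
move=> rI rI' rfI rfI' boundN MC NM sf sf'.
have N0 i : 0 < N i by case/andP: (boundN i).
have NC i : N i <= C by case/andP: (boundN i).
exists (common_cover rI rfI rfI' NC NM); split.
  by apply: common_cover_covers_left.
(* The projection to [H'] is the swap onto the cover built from [H'] and [H], followed by the left
   projection of the latter. *)
apply: (@covers_trans _ (common_cover rI' rfI' rfI NC NM)).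
  apply: (@iso_covers (common_cover rI rfI rfI' NC NM)
    (common_cover rI' rfI' rfI NC NM) (@swap_fiber _ _ _ _ _ _ _)
    (@swap_fiber _ _ _ _ _ _ _)).
  - by exists (@swap_fiber _ _ _ _ _ _ _); apply: swap_fiberK.
  - by exists (@swap_fiber _ _ _ _ _ _ _); apply: swap_fiberK.
  move=> p q; rewrite !inE.
  have /andP[/eqP cp _] := valP p; have /andP[/eqP cq _] := valP q.
  exact: (@glued_swap _ _ v w C (incidence_graph f g) (incidence_graph f' g')).
by apply: common_cover_covers_left.
Qed.

(** * Counting incidences and choosing the sizes *)

(** Both sides count the incidences between color [i] and color [j]. *)
Lemma double_count (K L : eqType) (H : bicolored K L) v w i j :
    lregular H v -> lregular (flip H) w ->
  #|[set a : lnode H | lcol a == i]| * v i j =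
  #|[set b : rnode H | rcol b == j]| * w j i.
Proof.
move=> rH rfH.
have -> : #|[set a : lnode H | lcol a == i]| * v i j =
    \sum_(a : lnode H | lcol a == i) \sum_(b : rnode H | rcol b == j) inc a b.
  rewrite cardsE -sum_nat_const; apply: eq_bigr => a /eqP <-.
  rewrite -rH -sum1_card -big_mkcondr /=; apply: eq_bigl => b.
  by rewrite inE andbC.
rewrite exchange_big /= cardsE -sum_nat_const; apply: eq_bigr => b /eqP <-.
rewrite -rfH -sum1_card -big_mkcondr /=; apply: eq_bigl => a.
by rewrite inE /= andbC.
Qed.

Lemma perfect_coloring_regular (H : multihypergraph) (k l : nat)
    (f : vertex H -> 'I_k) gamma (V : 'M[nat]_(k, l)) (W : 'M[nat]_(l, k)) :
    perfect_coloring f gamma V W ->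
  exists g : hyperedge H -> 'I_l,
    [/\ surjective g, lregular (incidence_graph f g) (fun i j => V i j)
      & lregular (flip (incidence_graph f g)) (fun j i => W j i)].
Proof.
case=> _ [gamma_inj ranges] vp rp.
have /fin_all_exists[g gE] e : exists j, gamma j = color_range f e.
  by apply/ranges; exists e.
exists g; split=> [j|x j|e i].
- have [e eE] : exists e, color_range f e = gamma j by apply/ranges; exists j.
  by exists e; apply: gamma_inj; rewrite gE.
- rewrite /= -(vp _ j x erefl); apply: eq_card => e.
  by rewrite !inE -gE (inj_eq gamma_inj).
(* The multiplicity of [i] in the color range of [e] is the number of ends of [e] of color [i]. *)
rewrite /= rp gE /color_range mset_seqE count_map -size_filter cardE.
rewrite /enum_mem -filter_predI; congr size; apply: eq_filter => x.
by rewrite /= !inE andbC.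
Qed.

Theorem theorem12 (H H' : multihypergraph) (k l : nat)
    (gamma : 'I_l -> {mset 'I_k}%mset) (V : 'M[nat]_(k, l)) (W : 'M[nat]_(l, k))
    (f : vertex H -> 'I_k) (f' : vertex H' -> 'I_k) :
  connected H -> connected H' ->
  perfect_coloring f gamma V W -> perfect_coloring f' gamma V W ->
  exists G : multihypergraph, covers G H /\ covers G H'.
Proof.
move=> _ _ pf pf'.
have [g [sg rI rfI]] := perfect_coloring_regular pf.
have [g' [_ rI' rfI']] := perfect_coloring_regular pf'.
have sf := coloring_surjective pf; have sf' := coloring_surjective pf'.
pose n i := #|[set x | f x == i]|; pose m j := #|[set e | g e == j]|.
have n_gt0 i : 0 < n i.
  by apply/card_gt0P; have [x fx] := sf i; exists x; rewrite inE fx.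
have m_gt0 j : 0 < m j.
  by apply/card_gt0P; have [e ge] := sg j; exists e; rewrite inE ge.
(* [.-1.+1] turns zero entries of [V] into 1, which keeps [C] positive, and leaves the others
   unchanged. *)
pose C := \prod_i n i * \prod_j m j * \prod_i \prod_j (n i * (V i j).-1.+1).
have nC i : n i %| C.
  by rewrite /C (bigD1 i) //= -!mulnA dvdn_mulr.
have mC j : m j %| C.
  by rewrite /C [\prod_j m j](bigD1 j) //= mulnAC dvdn_mull // dvdn_mulr.
have nVC i j : 0 < V i j -> n i * V i j %| C.
  move=> V_gt0; rewrite /C dvdn_mull // (bigD1 i) //= dvdn_mulr //.
  by rewrite (bigD1 j) //= prednK // dvdn_mulr.
have C_gt0 : 0 < C.
  rewrite !muln_gt0 !prodn_gt0 // => i; apply: prodn_gt0 => j.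
  by rewrite muln_gt0 n_gt0.
apply: (@common_covers H H' _ _ f f' g g' (fun i j => V i j) (fun j i => W j i)
  (fun i => C %/ n i) (fun j => C %/ m j) C) => // [i|j|i j V0 W0].
- by rewrite divn_gt0 // dvdn_leq //= leq_div.
- exact: leq_div.
(* Both quotients required to agree are [C] divided by this common value. *)
have eqVW : n i * V i j = m j * W j i := double_count i j rI rfI.
split; last by rewrite -!divnMA eqVW.
  by rewrite dvdn_divRL // mulnC nVC.
by rewrite dvdn_divRL // mulnC -eqVW nVC.
Qed.
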